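(* Let $\mathscr{A}$ be a finite Boolean algebra and let $p_{\mathscr{A}}$ be a probability measure on $\mathscr{A}$. Define $FP_{p_{\mathscr{A}}} : \mathscr{A} \times \mathscr{A} \rightarrow [0,1]$ by \[FP_{p_{\mathscr{A}}}(A_1, A_2) = p_{\mathscr{A}}(A_1^{C} \vee A_2) \quad \text{for } A_1, A_2 \in \mathscr{A}.\] Then $FP_{p_{\mathscr{A}}}$ is an uncertain implication argument from $\mathscr{A}$ to $\mathscr{A}$ and an uncertain inference argument from $\mathscr{A}$ to $\mathscr{A}$.
   Context: All Boolean algebras are finite. For a Boolean algebra $\mathscr{A}$, $F_{\mathscr{A}}$ and $T_{\mathscr{A}}$ denote its least and greatest elements, $A^{C}$ denotes the complement of $A \in \mathscr{A}$, and $n(A)$ denotes the number of elements of $A$ when $\mathscr{A}$ is viewed as an algebra of subsets of a finite set (equivalently, the number of atoms below $A$, i.e. the distance from $A$ to the least element $F_{\mathscr{A}}$). For $A_1, A_2 \in \mathscr{A}$, $A_1 \implies A_2$ means $A_1^{C} \vee A_2 = T_{\mathscr{A}}$ (i.e. $A_1 \le A_2$). A probability measure on $\mathscr{A}$ is a finitely additive function $p_{\mathscr{A}} : \mathscr{A} \to [0,1]$ with $p_{\mathscr{A}}(T_{\mathscr{A}}) = 1$. If $\mathscr{A}$ and $\mathscr{B}$ are Boolean algebras, an argument from $\mathscr{A}$ to $\mathscr{B}$ is a function $FP : \mathscr{A} \times \mathscr{B} \to [0,1]$ such that for all $A, A_1, A_2 \in \mathscr{A}$ and $B, B_1, B_2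 \in \mathscr{B}$: (i) $FP(F_{\mathscr{A}}, B) = 1$; (ii) $FP(A, T_{\mathscr{B}}) = 1$; (iii) $FP(T_{\mathscr{A}}, F_{\mathscr{B}}) = 0$; (iv) if $A_1 \implies A_2$, then $FP(A_1, B) \geq FP(A_2, B)$; (v) if $B_1 \implies B_2$, then $FP(A, B_1) \leq FP(A, B_2)$. For an argument $FP$ from $\mathscr{A}$ to $\mathscr{B}$, define real-valued functions $\overrightarrow{FP}$ and $\overleftarrow{FP}$ on $\mathscr{A} \times \mathscr{B}$ by \[\overrightarrow{FP}(A, B) = \sum_{\overline{A} \in \mathscr{A},\; A \implies \overline{A}} (-1)^{n(A) - n(\overline{A})} FP(\overline{A}, B),\] \[\overleftarrow{FP}(A, B) = \sum_{\overline{B} \in \mathscr{B},\; \overline{B} \implies B} (-1)^{n(B) - n(\overline{B})} FP(A, \overline{B}).\] An argument $FP$ is an uncertain implication argument if $\overrightarrow{FP}(A,B) \geq 0$ for all $A \in \mathscr{A}$, $B \in \mathscr{B}$, and an uncertain inference argument if $\overleftarrow{FP}(A,B) \geq 0$ for all $A \in \mathscr{A}$, $B \in \mathscr{B}$. *)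

(* Defs.v *)
From HB Require Import structures.
From mathcomp Require Import all_boot all_order all_algebra.
From mathcomp Require Import reals.

Set Implicit Arguments.
Unset Strict Implicit.
Unset Printing Implicit Defensive.

Import Order.TTheory GRing.Theory Num.Theory.
Local Open Scope ring_scope.

Section BooleanAlgebra.
Context {d : Order.disp_t} {T : finCTBDistrLatticeType d}.
Implicit Types A : T.

Definition ba_implies A1 A2 : bool := (~` A1 `|` A2 == \top)%O.

Definition is_atom A : bool :=
  (A != \bot)%O && [forall C : T, (C <= A)%O ==> (C == \bot)%O || (C == A)].

Definition natoms A : nat := #|[set C : T | is_atom C & (C <= A)%O]|.

Record probability_measure (R : realType) (p : T -> R) : Prop := {
  pm_range : forall A, 0 <= p A <= 1;
  pm_top : p (\top)%O = 1;
  pm_additive : forall A1 A2,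
    (A1 `&` A2)%O = (\bot)%O -> p (A1 `|` A2)%O = p A1 + p A2
}.

Definition FP_of (R : realType) (p : T -> R) (A1 A2 : T) : R :=
  p (~` A1 `|` A2)%O.

End BooleanAlgebra.

Section Arguments.
Context {dA dB : Order.disp_t}.
Context {TA : finCTBDistrLatticeType dA} {TB : finCTBDistrLatticeType dB}.
Context {R : realType}.
Implicit Types (FP : TA -> TB -> R) (A : TA) (B : TB).

Record argument FP : Prop := {
  arg_range : forall A B, 0 <= FP A B <= 1;
  arg_bot_l : forall B, FP (\bot)%O B = 1;
  arg_top_r : forall A, FP A (\top)%O = 1;
  arg_top_bot : FP (\top)%O (\bot)%O = 0;
  arg_anti_l : forall A1 A2 B, ba_implies A1 A2 -> FP A1 B >= FP A2 B;
  arg_mono_r : forall A B1 B2, ba_implies B1 B2 -> FP A B1 <= FP A B2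
}.

(* The exponents are differences in int, so the powers are integer powers;
   in [rarrow] the exponent is nonpositive. *)
Definition rarrow FP A B : R :=
  \sum_(A' : TA | ba_implies A A')
    (-1) ^ ((natoms A)%:Z - (natoms A')%:Z) * FP A' B.

Definition larrow FP A B : R :=
  \sum_(B' : TB | ba_implies B' B)
    (-1) ^ ((natoms B)%:Z - (natoms B')%:Z) * FP A B'.

Definition uncertain_implication FP : Prop :=
  argument FP /\ forall A B, 0 <= rarrow FP A B.

Definition uncertain_inference FP : Prop :=
  argument FP /\ forall A B, 0 <= larrow FP A B.

End Arguments.

(* Main.v *)
Require Import Defs.
From mathcomp Require Import all_boot all_order all_algebra.
From mathcomp Require Import reals.

(** In either variable, FP changes by an amount independent of X when a fixed
    atom a is joined to an element X disjoint from it. Pairing X with X `|` a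
    therefore turns an alternating sum over an interval [L, U] into the
    alternating sum of a constant over [L, U \ a], which vanishes by the same
    pairing as soon as U \ a is not L. Only intervals of length 0 or 1
    contribute, and there the sum is a single value of FP or of p. *)

Set Implicit Arguments.
Unset Strict Implicit.
Unset Printing Implicit Defensive.

Import Order.TTheory Order.CTheory GRing.Theory Num.Theory.
Local Open Scope ring_scope.

Section Atoms.
Context {d : Order.disp_t} {T : finCTBDistrLatticeType d}.
Implicit Types a L U X Y A B : T.

Lemma ba_impliesE X Y : ba_implies X Y = (X <= Y)%O.
Proof.
by rewrite /ba_implies -complB -compl0 (inj_eq compl_inj) diff_eq0.
Qed.

(** The meet lies below the atom [a], so it is either [\bot] or [a] itself. *)
Lemma atom_meet_neq0 a X : is_atom a -> ((a `&` X)%O != \bot%O) = (a <= X)%O.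
Proof.
case/andP=> a0 /forallP/(_ (a `&` X)%O); rewrite leIl /=.
case/orP=> [/eqP aX|/eqP aX].
  rewrite aX eqxx; apply/esym/negbTE; apply: contra a0.
  by rewrite leEmeet aX eq_sym.
by rewrite aX a0 leEmeet aX eqxx.
Qed.

Lemma exists_atom X : X != \bot%O -> exists2 a, is_atom a & (a <= X)%O.
Proof.
move=> X0; pose P Y := (Y != \bot%O) && (Y <= X)%O.
have PX : P X by rewrite /P X0 lexx.
(* Down-sets grow strictly with their top, so a nonzero element below [X] with the smallest down-set
   has nothing strictly between [\bot] and itself. *)
case: (arg_minnP (fun Y => #|[set Z : T | (Z <= Y)%O]|) PX).
move=> a /andP[a0 aX] amin; exists a => //.
rewrite /is_atom a0; apply/forallP => C; apply/implyP => Ca.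
case: eqVneq => //= C0; apply/negPn/negP => Cna.
have := amin C; rewrite /P C0 (le_trans Ca aX) leqNgt => /(_ isT)/negP; apply.
apply: proper_card; apply/properP; split.
  by apply/subsetP => Z; rewrite !inE => /le_trans; apply.
exists a; rewrite !inE ?lexx //; apply: contra Cna => aC.
by rewrite eq_le Ca aC.
Qed.

Lemma natoms_joinr a X : is_atom a -> (a `&` X = \bot)%O ->
  natoms (X `|` a)%O = (natoms X).+1.
Proof.
move=> at_a aX; rewrite /natoms.
have -> : [set C : T | is_atom C & (C <= X `|` a)%O] =
          a |: [set C : T | is_atom C & (C <= X)%O].
  apply/setP => C; rewrite !inE.
  case: eqVneq => [->|Ca] /=; first by rewrite at_a leUr.
  case: (boolP (is_atom C)) => //= at_C; rewrite -!(atom_meet_neq0 _ at_C).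
  (* Two distinct atoms are disjoint, so an atom [C] other than [a] meets the join only through
     [X]. *)
  rewrite meetUr; suff -> : (C `&` a = \bot)%O by rewrite joinx0.
  apply/eqP/negPn; rewrite atom_meet_neq0 //; apply: contra Ca => Ca.
  case/andP: at_a => _ /forallP/(_ C); rewrite Ca /=.
  by case/andP: at_C => /negbTE ->.
by rewrite cardsU1 inE -(atom_meet_neq0 _ at_a) aX eqxx andbF.
Qed.

(** Since [a] is below [U] and disjoint from [L], joining or removing it stays in the interval;
    joining it to an element disjoint from it flips the sign. *)
Lemma alternating_sum_atom (R : pzRingType) (f : T -> R) L U a :
  is_atom a -> (a <= U)%O -> (a `&` L = \bot)%O ->
  \sum_(X : T | (L <= X <= U)%O) (-1) ^+ natoms X * f X =
  \sum_(X : T | (L <= X <= U `\` a)%O)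
     (-1) ^+ natoms X * (f X - f (X `|` a)%O).
Proof.
move=> at_a aU aL.
under [RHS]eq_bigr do rewrite mulrBr.
rewrite sumrB (bigID (fun X => (a <= X)%O)) /= addrC; congr (_ + _).
  apply: eq_bigl => X.
  by rewrite leBRL -(atom_meet_neq0 _ at_a) negbK meetC andbA.
(* The elements above [a] are the joins [X]|[a]; the round trip through [X]\[a] returns [X] exactly
   when [X] is disjoint from [a]. *)
rewrite -sumrN (reindex_onto (fun X => X `|` a)%O (fun X => X `\` a)%O) /=.
  apply: eq_big => X => [|/andP[_ /eqP X_a]].
    have XaE : ((X `|` a) `\` a == X)%O = ((X `&` a)%O == \bot%O).
      rewrite joinBK; apply/eqP/eqP => [<-|/eqP/disj_diffl->//].
      exact: diffIK.
    rewrite leUr leUx aU !andbT XaE leBRL andbA; congr (_ && _ && _).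
    by rewrite joinC -leBLR disj_diffl // meetC aL.
  rewrite natoms_joinr // ?exprS ?mulN1r ?mulNr //.
  by rewrite -X_a meetC diffIK.
by move=> X /andP[_ aX]; rewrite diffUK; apply: join_l.
Qed.

Lemma exists_atom_between L U : (L <= U)%O -> L != U ->
  exists a, [/\ is_atom a, (a <= U)%O & (a `&` L = \bot)%O].
Proof.
move=> LU LnU.
have /exists_atom[a at_a] : (U `\` L)%O != \bot%O.
  by rewrite diff_eq0; apply: contra LnU => UL; rewrite eq_le LU UL.
by rewrite leBRL => /andP[aU /eqP aL]; exists a.
Qed.

Lemma alternating_sum_const (R : pzRingType) (c : R) L U :
  (L <= U)%O -> L != U ->
  \sum_(X : T | (L <= X <= U)%O) (-1) ^+ natoms X * c = 0.
Proof.
move=> LU /(exists_atom_between LU)[a [at_a aU aL]].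
rewrite (alternating_sum_atom _ at_a aU aL).
by apply: big1 => X _; rewrite subrr mulr0.
Qed.

(** The last two cases are intervals of length 0 and 1; longer ones give 0. The atom count of [U] is
    recorded because one arrow takes its sign at the bottom of the interval and the other at the
    top. *)
Lemma alternating_sum_modular (R : pzRingType) (f g : T -> R) L U :
  (forall a X, is_atom a -> (a `&` X = \bot)%O ->
     f (X `|` a)%O = f X + g a) ->
  (L <= U)%O ->
  let S := \sum_(X : T | (L <= X <= U)%O) (-1) ^+ natoms X * f X in
  [\/ S = 0,
      L = U /\ S = (-1) ^+ natoms L * f L |
      exists a, [/\ natoms U = (natoms L).+1 & S = - ((-1) ^+ natoms L * g a)]].
Proof.
move=> fD LU S; have [LeqU|LnU] := eqVneq L U.
  constructor 2; split=> //; rewrite /S -LeqU (big_pred1 L) // => X.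
  by rewrite /= eq_le andbC.
have [a [at_a aU aL]] := exists_atom_between LU LnU.
have SE : S = \sum_(X : T | (L <= X <= U `\` a)%O) (-1) ^+ natoms X * - g a.
  rewrite /S (alternating_sum_atom _ at_a aU aL).
  apply: eq_bigr => X; rewrite leBRL => /and3P[_ _ /eqP Xa].
  by rewrite fD 1?meetC // opprD addNKr.
have LUa : (L <= U `\` a)%O by rewrite leBRL LU meetC aL eqxx.
have [LE|LnUa] := eqVneq L (U `\` a)%O; last first.
  by constructor 1; rewrite SE alternating_sum_const.
constructor 3; exists a; split.
  by rewrite -(natoms_joinr at_a aL) LE leBUK.
rewrite SE -LE (big_pred1 L) ?mulrN // => X.
by rewrite /= eq_le andbC.
Qed.

End Atoms.

(** A sign is its own inverse, so negative exponents are harmless and the sign of the fixed endpoint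
    can leave the sum. *)
Lemma signrzB (R : numFieldType) (m n : nat) :
  (-1 : R) ^ (m%:Z - n%:Z) = (-1) ^+ m * (-1) ^+ n.
Proof. by rewrite expfzDr ?oppr_eq0 ?oner_eq0 // -invr_expz invr_sign. Qed.

Section ProbabilityMeasure.
Context {R : realType} {d : Order.disp_t} {T : finCTBDistrLatticeType d}.
Context (p : T -> R) (p_prob : probability_measure p).
Implicit Types a X A B : T.

Lemma probability_ge0 X : 0 <= p X.
Proof. by have /andP[] := pm_range p_prob X. Qed.

Lemma probability_bot : p \bot%O = 0.
Proof.
have := pm_additive p_prob (meetxx (\bot%O : T)).
by rewrite joinxx => /eqP; rewrite -subr_eq0 opprD addNKr oppr_eq0 => /eqP.
Qed.

Lemma probability_le X Y : (X <= Y)%O -> p X <= p Y.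
Proof.
move=> XY; rewrite -(leBKU XY) (pm_additive p_prob) ?lerDl ?probability_ge0 //.
exact: diffKI.
Qed.

Lemma FP_ge0 A B : 0 <= FP_of p A B.
Proof. exact: probability_ge0. Qed.

(** The part of [a] outside [A] already lies in [~]
    A[; only the part inside]A[is new, and it is disjoint from both]~[A] and [X]. *)
Lemma FP_joinr A X a : (a `&` X = \bot)%O ->
  FP_of p A (X `|` a)%O = FP_of p A X + p (a `&` A)%O.
Proof.
move=> aX; rewrite /FP_of -(pm_additive p_prob); last first.
  rewrite meetC meetUr -meetA meetxC meetx0 join0x.
  by rewrite meetAC aX meet0x.
congr p; rewrite joinIr [(_ `|` A)%O]joinAC joinCx join1x meetx1.
by rewrite joinA.
Qed.

(** This exchanges the two variables, so that the rule for the first follows from the rule for the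
    second. *)
Lemma FP_contrapositive A B : FP_of p A B = FP_of p (~` B)%O (~` A)%O.
Proof. by rewrite /FP_of complK joinC. Qed.

Lemma FP_joinl X B a : (a `&` X = \bot)%O ->
  FP_of p (X `|` a)%O B = FP_of p X B - p (a `&` ~` B)%O.
Proof.
move=> aX; rewrite !(FP_contrapositive _ B).
have aC : (a `&` ~` (X `|` a) = \bot)%O.
  by rewrite complU meetCA meetxC meetx0.
(* Enlarging [X] by [a] removes [a] from the complement; joining it back there puts the difference
   in the form of [FP_joinr]. *)
have -> : (~` X = ~` (X `|` a) `|` a)%O.
  rewrite complU joinIl joinCx meetx1; apply/esym/join_l.
  by rewrite -disj_leC aX.
by rewrite FP_joinr // addrK.
Qed.

Lemma FP_argument : argument (FP_of p).
Proof.
split=> [A B|B|A||A1 A2 B|A B1 B2]; rewrite /FP_of.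
- exact: pm_range.
- by rewrite compl0 join1x (pm_top p_prob).
- by rewrite joinx1 (pm_top p_prob).
- by rewrite compl1 joinxx probability_bot.
- by rewrite ba_impliesE => A12; rewrite probability_le // leU2 // leC.
- by rewrite ba_impliesE => B12; rewrite probability_le // leU2.
Qed.

Lemma rarrow_FP_ge0 A B : 0 <= rarrow (FP_of p) A B.
Proof.
have -> : rarrow (FP_of p) A B = (-1) ^+ natoms A *
    \sum_(X : T | (A <= X <= \top)%O) (-1) ^+ natoms X * FP_of p X B.
  rewrite mulr_sumr; apply: eq_big => X; first by rewrite ba_impliesE lex1 andbT.
  by rewrite signrzB mulrA.
have fD a X : is_atom a -> (a `&` X = \bot)%O ->
    FP_of p (X `|` a)%O B = FP_of p X B + - p (a `&` ~` B)%O.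
  by move=> _ /FP_joinl ->.
case: (alternating_sum_modular fD (lex1 A)) => [->|[_ ->]|[a [_ ->]]].
- by rewrite mulr0.
- by rewrite signrMK FP_ge0.
- by rewrite mulrN signrMK opprK probability_ge0.
Qed.

Lemma larrow_FP_ge0 A B : 0 <= larrow (FP_of p) A B.
Proof.
have -> : larrow (FP_of p) A B = (-1) ^+ natoms B *
    \sum_(X : T | (\bot <= X <= B)%O) (-1) ^+ natoms X * FP_of p A X.
  rewrite mulr_sumr; apply: eq_big => X; first by rewrite ba_impliesE le0x.
  by rewrite signrzB mulrA.
have fD a X : is_atom a -> (a `&` X = \bot)%O ->
    FP_of p A (X `|` a)%O = FP_of p A X + p (a `&` A)%O.
  by move=> _ /FP_joinr ->.
(* Here the increment is a probability; for length 1 the sign at [B] is opposite to the sign at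
   [\bot], which cancels the minus sign of the sum. *)
case: (alternating_sum_modular fD (le0x B)) => [->|[<- ->]|[a [-> ->]]].
- by rewrite mulr0.
- by rewrite signrMK FP_ge0.
- by rewrite exprS mulN1r mulrNN signrMK probability_ge0.
Qed.

End ProbabilityMeasure.

Theorem theorem2 (R : realType) (d : Order.disp_t)
    (T : finCTBDistrLatticeType d) (p : T -> R) :
  probability_measure p ->
  uncertain_implication (FP_of p) /\ uncertain_inference (FP_of p).
Proof.
move=> p_prob; split; split; try exact: FP_argument.
- exact: rarrow_FP_ge0.
- exact: larrow_FP_ge0.
Qed.
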